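(* For every $r\ge1$, $$\{\Gamma\in\widehat{\mathcal U}: t_{\mathrm{ind}}(K_r,\Gamma)=t_{\mathrm{ind}}(E_r,\Gamma)=0\}=\emptyset.$$
   Context: All graphs are finite and simple (with at least one vertex). $\mathcal U$ is the set of all unlabelled graphs (isomorphism classes of graphs), and $|G|$ is the number of vertices of $G$. For graphs $F,G$, $t(F,G)$ is the probability that a uniformly random map $V(F)\to V(G)$ is a graph homomorphism, and $t_{\mathrm{ind}}(F,G)$ is, when $|F|\le|G|$, the probability that a uniformly random injective map $V(F)\to V(G)$ is an isomorphism onto an induced subgraph of $G$ (and $0$ when $|F|>|G|$). The space $\overline{\mathcal U}$: embed $\mathcal U$ in $[0,1]^{\mathcal U}\times[0,1]$ by $G\mapsto((t(F,G))_{F\in\mathcal U},1/|G|)$ and let $\overline{\mathcal U}$ be the closure of the image; it is a compact metrizable space in which $\mathcal U$ is a countable, discrete, dense, open subset. The elements of $\widehat{\mathcal U}:=\overline{\mathcal U}\setminus\mathcal U$ are called graph limits. For each fixed graph $F$, $t(F,\cdot)$ and $t_{\mathrm{ind}}(F,\cdot)$ extend by continuity to $\overline{\mathcal U}$. $K_r$ is the complete graph and $E_r=\overline{K_r}$ the empty (edgeless) graph on $r$ vertices. *)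

(* Defs.v *)
From HB Require Import structures.
From mathcomp Require Import all_boot all_order all_algebra.
From mathcomp Require Import generic_quotient.
From mathcomp Require Import all_classical all_reals all_analysis.

Set Implicit Arguments.
Unset Strict Implicit.
Unset Printing Implicit Defensive.

Import Order.TTheory GRing.Theory Num.Theory.
Import numFieldNormedType.Exports.

Local Open Scope quotient_scope.
Local Open Scope classical_set_scope.
Local Open Scope ring_scope.

Definition simple n (e : {ffun 'I_n -> {ffun 'I_n -> bool}}) : bool :=
  [forall x, forall y, e x y == e y x] && [forall x, ~~ e x x].

Record sgraph (n : nat) := SGraph {
  sg_adj : {ffun 'I_n -> {ffun 'I_n -> bool}};
  _ : simple sg_adj }.

HB.instance Definition _ n := [isSub for @sg_adj n].
HB.instance Definition _ n := [Finite of sgraph n by <:].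

(* [existT _ n g] has n.+1 vertices, so a graph is never empty. *)
Definition lgraph := {n : nat & sgraph n.+1}.

Definition lorder (G : lgraph) : nat := (tag G).+1.
Definition vertex (G : lgraph) := 'I_(lorder G).
Definition adj (G : lgraph) (x y : vertex G) : bool := sg_adj (tagged G) x y.

HB.instance Definition _ (G : lgraph) := Finite.on (vertex G).

Lemma adj_sym (G : lgraph) (x y : vertex G) : adj x y = adj y x.
Proof.
rewrite /adj; case: (tagged G) => g /= /andP[/forallP gs _].
by have /forallP/(_ y)/eqP := gs x.
Qed.

Lemma adj_irr (G : lgraph) (x : vertex G) : adj x x = false.
Proof.
rewrite /adj; case: (tagged G) => g /= /andP[_ /forallP gi].
exact: negbTE (gi x).
Qed.

Definition is_hom (F G : lgraph) (f : {ffun vertex F -> vertex G}) : bool :=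
  [forall x, forall y, adj x y ==> adj (f x) (f y)].

Definition is_ind (F G : lgraph) (f : {ffun vertex F -> vertex G}) : bool :=
  injectiveb f && [forall x, forall y, adj (f x) (f y) == adj x y].

Definition giso (F G : lgraph) : bool :=
  (lorder F == lorder G) && [exists f : {ffun vertex F -> vertex G}, is_ind f].

Lemma is_indP (F G : lgraph) (f : {ffun vertex F -> vertex G}) :
  reflect (injective f /\ forall x y, adj (f x) (f y) = adj x y) (is_ind f).
Proof.
apply: (iffP andP) => -[/injectiveP fi fa]; split=> //.
  by move=> x y; have /forallP/(_ x)/forallP/(_ y)/eqP := fa.
by apply/forallP=> x; apply/forallP=> y; rewrite fa.
Qed.

Lemma gisoP (F G : lgraph) :
  reflect (exists2 f : vertex F -> vertex G, bijective f &
             forall x y, adj (f x) (f y) = adj x y) (giso F G).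
Proof.
apply: (iffP andP) => [[/eqP eFG /existsP[f /is_indP[fi fa]]]|[f fb fa]].
  exists f => //; apply: inj_card_bij => //.
  by rewrite !card_ord eFG.
split; first by have := bij_eq_card fb; rewrite !card_ord => ->.
apply/existsP; exists [ffun x => f x]; apply/is_indP; split=> [x y|x y].
  by rewrite !ffunE; apply: bij_inj.
by rewrite !ffunE.
Qed.

Lemma giso_refl : reflexive giso.
Proof. by move=> G; apply/gisoP; exists id => //; exists id. Qed.

Lemma giso_sym : symmetric giso.
Proof.
have imp F G : giso F G -> giso G F.
  move=> /gisoP[f [g fK gK] fa]; apply/gisoP; exists g; first by exists f.
  by move=> x y; rewrite -fa !gK.
by move=> F G; apply/idP/idP; apply: imp.
Qed.

Lemma giso_trans : transitive giso.
Proof.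
move=> G F H /gisoP[f fb fa] /gisoP[g gb ga].
apply/gisoP; exists (g \o f); first exact: bij_comp.
by move=> x y; rewrite /= ga fa.
Qed.

Canonical giso_equiv := EquivRel giso giso_refl giso_sym giso_trans.

Definition ugraph := {eq_quot giso_equiv}.
HB.instance Definition _ := Choice.on ugraph.
HB.instance Definition _ := EqQuotient.on ugraph.

Section Densities.
Variable R : realType.

Definition lhom_density (F G : lgraph) : R :=
  #|[set f : {ffun vertex F -> vertex G} | is_hom f]%SET|%:R
  / #|{ffun vertex F -> vertex G}|%:R.

Definition lind_density (F G : lgraph) : R :=
  if (lorder F <= lorder G)%N then
    #|[set f : {ffun vertex F -> vertex G} | is_ind f]%SET|%:R
    / #|[set f : {ffun vertex F -> vertex G} | injectiveb f]%SET|%:R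
  else 0.

Definition gorder (G : ugraph) : nat := lorder (repr G).
Definition hom_density (F G : ugraph) : R := lhom_density (repr F) (repr G).
Definition ind_density (F G : ugraph) : R := lind_density (repr F) (repr G).

End Densities.

Section Invariance.

Lemma leq_card_giso (P : forall F G, {ffun vertex F -> vertex G} -> bool)
    (F F' G G' : lgraph) :
  (forall (a : vertex F' -> vertex F) (b : vertex G -> vertex G')
     (f : {ffun vertex F -> vertex G}),
     bijective a -> bijective b ->
     (forall x y, adj (a x) (a y) = adj x y) ->
     (forall x y, adj (b x) (b y) = adj x y) ->
     P F G f -> P F' G' [ffun x => b (f (a x))]) ->
  giso F F' -> giso G G' ->
  (#|[set f | P F G f]%SET| <= #|[set f | P F' G' f]%SET|)%N.
Proof.
move=> PP; rewrite giso_sym => /gisoP[a ab aa] /gisoP[b bb ba].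
pose c (f : {ffun vertex F -> vertex G}) : {ffun vertex F' -> vertex G'} :=
  [ffun x => b (f (a x))].
have ci : injective c.
  move=> f g /ffunP fg; apply/ffunP => x.
  have [a' aK a'K] := ab.
  by have := fg (a' x); rewrite !ffunE a'K => /(bij_inj bb).
rewrite -(card_imset _ ci); apply: subset_leq_card.
apply/fintype.subsetP => _ /imsetP[f + ->]; rewrite !inE => Pf.
exact: PP.
Qed.

Lemma is_hom_transport (F F' G G' : lgraph) (a : vertex F' -> vertex F)
    (b : vertex G -> vertex G') (f : {ffun vertex F -> vertex G}) :
  bijective a -> bijective b ->
  (forall x y, adj (a x) (a y) = adj x y) ->
  (forall x y, adj (b x) (b y) = adj x y) ->
  is_hom f -> is_hom [ffun x => b (f (a x))].
Proof.
move=> _ _ aa ba hf; apply/forallP => x; apply/forallP => y.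
rewrite !ffunE ba -aa.
by have /forallP/(_ (a x))/forallP/(_ (a y)) := hf.
Qed.

Lemma inj_transport (F F' G G' : lgraph) (a : vertex F' -> vertex F)
    (b : vertex G -> vertex G') (f : {ffun vertex F -> vertex G}) :
  bijective a -> bijective b ->
  injectiveb f -> injectiveb [ffun x => b (f (a x))].
Proof.
move=> ab bb /injectiveP fi; apply/injectiveP => x y.
by rewrite !ffunE => /(bij_inj bb)/fi/(bij_inj ab).
Qed.

Lemma is_ind_transport (F F' G G' : lgraph) (a : vertex F' -> vertex F)
    (b : vertex G -> vertex G') (f : {ffun vertex F -> vertex G}) :
  bijective a -> bijective b ->
  (forall x y, adj (a x) (a y) = adj x y) ->
  (forall x y, adj (b x) (b y) = adj x y) ->
  is_ind f -> is_ind [ffun x => b (f (a x))].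
Proof.
move=> ab bb aa ba /andP[fi fa]; apply/andP; split.
  exact: inj_transport.
apply/forallP => x; apply/forallP => y; rewrite !ffunE ba -(aa x y).
by have /forallP/(_ (a x))/forallP/(_ (a y)) := fa.
Qed.

Lemma giso_order (F G : lgraph) : giso F G -> lorder F = lorder G.
Proof. by case/andP => /eqP. Qed.

Lemma giso_repr_pi (G : lgraph) : giso (repr (\pi_ugraph G)) G.
Proof. by have /eqmodP := reprK (\pi_ugraph G). Qed.

Lemma gorder_pi (G : lgraph) : gorder (\pi_ugraph G) = lorder G.
Proof. exact: giso_order (giso_repr_pi G). Qed.

Variable R : realType.

Lemma lhom_density_giso (F F' G G' : lgraph) :
  giso F F' -> giso G G' -> lhom_density R F G = lhom_density R F' G'.
Proof.
move=> iF iG; have [iF' iG'] : giso F' F /\ giso G' G.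
  by rewrite !(giso_sym _ F) !(giso_sym _ G).
rewrite /lhom_density !card_ffun !card_ord (giso_order iF) (giso_order iG).
congr (_%:R / _); apply/eqP; rewrite eqn_leq.
by rewrite !(leq_card_giso (P := is_hom)) // => *; apply: is_hom_transport.
Qed.

Lemma lind_density_giso (F F' G G' : lgraph) :
  giso F F' -> giso G G' -> lind_density R F G = lind_density R F' G'.
Proof.
move=> iF iG; have [iF' iG'] : giso F' F /\ giso G' G.
  by rewrite !(giso_sym _ F) !(giso_sym _ G).
rewrite /lind_density (giso_order iF) (giso_order iG); case: ifP => // _.
congr (_%:R / _%:R); apply/eqP; rewrite eqn_leq.
  by rewrite !(leq_card_giso (P := is_ind)) // => *; apply: is_ind_transport.
pose P F G (f : {ffun vertex F -> vertex G}) := injectiveb f.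
by rewrite !(leq_card_giso (P := P)) // => *; apply: inj_transport.
Qed.

Lemma hom_density_pi (F G : lgraph) :
  hom_density R (\pi_ugraph F) (\pi_ugraph G) = lhom_density R F G.
Proof. exact: lhom_density_giso (giso_repr_pi F) (giso_repr_pi G). Qed.

Lemma ind_density_pi (F G : lgraph) :
  ind_density R (\pi_ugraph F) (\pi_ugraph G) = lind_density R F G.
Proof. exact: lind_density_giso (giso_repr_pi F) (giso_repr_pi G). Qed.

End Invariance.

Definition complete_adj n : {ffun 'I_n -> {ffun 'I_n -> bool}} :=
  [ffun x => [ffun y => x != y]].

Definition edgeless_adj n : {ffun 'I_n -> {ffun 'I_n -> bool}} :=
  [ffun=> [ffun=> false]].

Lemma complete_simple n : simple (complete_adj n).
Proof.
apply/andP; split; last by apply/forallP => x; rewrite !ffunE eqxx.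
by apply/forallP => x; apply/forallP => y; rewrite !ffunE (eq_sym x y).
Qed.

Lemma edgeless_simple n : simple (edgeless_adj n).
Proof.
apply/andP; split; last by apply/forallP => x; rewrite !ffunE.
by apply/forallP => x; apply/forallP => y; rewrite !ffunE.
Qed.

(* These graphs are only used for 0 < r, where r.-1.+1 = r. *)
Definition lcomplete (r : nat) : lgraph :=
  existT (fun n => sgraph n.+1) r.-1 (SGraph (complete_simple r.-1.+1)).
Definition ledgeless (r : nat) : lgraph :=
  existT (fun n => sgraph n.+1) r.-1 (SGraph (edgeless_simple r.-1.+1)).
Definition complete_graph (r : nat) : ugraph := \pi_ugraph (lcomplete r).
Definition edgeless_graph (r : nat) : ugraph := \pi_ugraph (ledgeless r).

Section GraphLimits.
Variable R : realType.

Definition ambient : Type := ({ptws ugraph -> R} * R)%type.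
HB.instance Definition _ := Topological.on ambient.

Definition embed (G : ugraph) : ambient :=
  ((fun F => hom_density R F G) : {ptws ugraph -> R}, (gorder G)%:R^-1).

(* Taken in R^U x R: by [Ubar_unit_cube] it lies in [0,1]^U x [0,1], hence it
   is also the closure of the image of [embed] in that subspace. *)
Definition Ubar : set ambient := closure (range embed).

Definition Uhat : set ambient := Ubar `\` range embed.

(* The extension by continuity of [phi] to Ubar: its value at Gam is the limit
   of [phi G] as [embed G] tends to Gam. Outside Ubar, or when the limit does
   not exist, [lim] gives a junk value. *)
Definition extend (phi : ugraph -> R) (Gam : ambient) : R :=
  lim (phi @ filter_from (nbhs Gam) (fun B => embed @^-1` B)).

Definition ind_density_ext (F : ugraph) (Gam : ambient) : R :=
  extend (ind_density R F) Gam.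

End GraphLimits.

Section UnitCube.
Variable R : realType.

Lemma hom_density_ge0 (F G : ugraph) : 0 <= hom_density R F G.
Proof. by rewrite divr_ge0 ?ler0n. Qed.

Lemma hom_density_le1 (F G : ugraph) : hom_density R F G <= 1.
Proof.
rewrite /hom_density /lhom_density; set N := #|{ffun _ -> _}|.
have N0 : (0 < N)%N by rewrite /N card_ffun !card_ord expn_gt0.
by rewrite ler_pdivrMr ?ltr0n // mul1r ler_nat max_card.
Qed.

Lemma Ubar_unit_cube (Gam : ambient R) : Ubar Gam ->
  (forall F, 0 <= Gam.1 F <= 1) /\ 0 <= Gam.2 <= 1.
Proof.
move=> clG.
have key (p : ambient R -> R) : continuous p ->
    (forall G, 0 <= p (embed R G) <= 1) -> 0 <= p Gam <= 1.
  move=> pc pG; have cl : closed (p @^-1` `[0, 1]).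
    by move/continuous_closedP: pc; apply; exact: itv_closed.
  have : (p @^-1` `[0, 1]) Gam.
    apply: cl; apply: closure_subset clG => _ [G _ <-] /=.
    by rewrite in_itv /= pG.
  by rewrite /= in_itv.
split=> [F|].
  apply: (key (fun x => x.1 F)) => [x|G];
    last by rewrite hom_density_ge0 hom_density_le1.
  apply: (@continuous_comp _ _ _ fst (fun f : {ptws ugraph -> R} => f F)).
    exact: cvg_fst.
  exact: (@proj_continuous _ (fun _ : ugraph => R : topologicalType) F).
apply: (key snd) => [x|G]; first exact: cvg_snd.
by rewrite /= invr_ge0 ler0n invf_le1 ?ler1n ?ltr0n.
Qed.

End UnitCube.

(* Main.v *)
Require Import Defs.
From mathcomp Require Import all_boot all_order all_algebra.
From mathcomp Require Import all_classical all_reals all_analysis.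
From mathcomp Require Import zify lra.
Local Open Scope classical_set_scope.
Local Open Scope ring_scope.

(** The statement is the limit form of Ramsey's theorem. Put N = 2 ^ (2 r). A
    map from N points to the vertices of a graph G pulls the adjacency of G
    back to a graph on the N points, which by Ramsey contains r points that are
    pairwise adjacent or pairwise nonadjacent. Averaging over all maps, the
    maps from r points to G that pull the adjacency back to K_r or to E_r have
    total density at least N ^ (- r) ([homogeneous_density_ge]), a bound that
    does not depend on G and hence passes to limits.

    To read this off the extended induced densities, one has to know that they
    really are limits as G tends to a graph limit Gam. Maps that need not be
    injective are the convenient intermediate notion: [ind_map_density F G] is
    the probability that a uniformly random map, injective or not, preserves
    both adjacency and nonadjacency. By inclusion-exclusion it is a finite
    integer combination of homomorphism densities, which converge by the very
    definition of the topology, so it converges ([ind_map_density_cvg]). It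
    differs from the induced density by at most the probability that a random
    map is not injective ([ind_density_close]), which tends to 0 because the
    orders of the graphs near Gam tend to infinity: otherwise finitely many
    graphs would accumulate at Gam, and Gam would be one of them
    ([limit_order0]). Thus both densities have the same limit
    ([ind_density_extE]), and for K_r and E_r these limits have a positive
    sum. *)

Set Implicit Arguments.
Unset Strict Implicit.
Unset Printing Implicit Defensive.

Import Order.TTheory GRing.Theory Num.Theory.
Import numFieldNormedType.Exports.

(** * Ramsey's theorem and its counting form *)

(** Induction on a + b: remove a vertex v; one of its neighbourhood and its
    non-neighbourhood keeps half of the set, and v extends any clique found in
    the former and any independent set found in the latter. *)
Lemma ramsey_pairwise (T : finType) (e : rel T) (a b : nat) (A : {set T}) :
  (2 ^ (a + b) <= #|A|)%N ->
  (exists s, [/\ uniq s, size s = a, {subset s <= A} & pairwise e s]) \/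
  (exists s, [/\ uniq s, size s = b, {subset s <= A} &
                 pairwise (fun x y => ~~ e x y) s]).
Proof.
move En: (a + b)%N => n; elim: n a b En A => [|n IHn] [|a] [|b] // En A cA;
  try by [left; exists [::] | right; exists [::]].
have /card_gt0P[v vA] : (0 < #|A|)%N by apply: leq_trans cA; rewrite expn_gt0.
pose B := [set x in A :\ v | e v x]%SET; pose C := [set x in A :\ v | ~~ e v x]%SET.
have cBC : #|A| = (#|B| + #|C|).+1.
  rewrite (cardsD1 v) vA add1n; congr _.+1.
  rewrite -(cardsID [set x | e v x]%SET (A :\ v)); congr (_ + _)%N;
  by apply: eq_card => x; rewrite !inE // andbC.
(* If both B and C had fewer than 2 ^ n elements, A would have fewer than
   2 ^ n.+1, even counting v. *)
have [cB|cB] := leqP (2 ^ n) #|B|.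
  have [|[s [us ss sB ps]]|[s [us ss sB ps]]] := IHn a b.+1 _ B cB; first by lia.
    left; exists (v :: s); split => /=.
    - by rewrite us andbT; apply/negP => /sB; rewrite !inE eqxx.
    - by rewrite ss.
    - by move=> x; rewrite inE => /predU1P[-> //|/sB]; rewrite !inE => /andP[/andP[]].
    - by rewrite ps andbT; apply/allP => x /sB; rewrite !inE => /andP[].
  right; exists s; split => // x /sB; by rewrite !inE => /andP[/andP[]].
have cC : (2 ^ n <= #|C|)%N by rewrite expnS in cA; lia.
have [|[s [us ss sB ps]]|[s [us ss sB ps]]] := IHn a.+1 b _ C cC; first by lia.
  left; exists s; split => // x /sB; by rewrite !inE => /andP[/andP[]].
right; exists (v :: s); split => /=.
- by rewrite us andbT; apply/negP => /sB; rewrite !inE eqxx.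
- by rewrite ss.
- by move=> x; rewrite inE => /predU1P[-> //|/sB]; rewrite !inE => /andP[/andP[]].
- by rewrite ps andbT; apply/allP => x /sB; rewrite !inE => /andP[].
Qed.

Lemma pairwise_sym_enum (T : eqType) (e : rel T) (s : seq T) (r : nat) :
  symmetric e -> uniq s -> size s = r -> pairwise e s ->
  exists2 h : 'I_r -> T, injective h & forall i j, i != j -> e (h i) (h j).
Proof.
move=> esym us <-; case: s us => [|v s'] us ps.
  by have h : 'I_0 -> T by [case]; exists h => -[].
set s := v :: s' in us ps *; exists (fun i : 'I_(size s) => nth v s i).
  by move=> i j /eqP; rewrite nth_uniq // => /eqP/val_inj.
have /(pairwiseP v) P := ps.
move=> i j; rewrite neq_ltn => /orP[] ij; last rewrite esym;
  by apply: P; rewrite ?inE //=.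
Qed.

(** A map g on U is determined by its composite with h and its restriction to
    the complement of the image of h. The restriction is encoded as the total
    map that takes the default value y on that image. *)
Lemma card_precomp_le (T U V : finType) (y : V) (h : T -> U)
    (A : {set {ffun T -> V}}) :
  injective h ->
  (#|[set g : {ffun U -> V} | [ffun x => g (h x)] \in A]%SET|
    <= #|A| * #|V| ^ (#|U| - #|T|))%N.
Proof.
move=> hi; pose D := ~: [set h x | x : T]%SET.
have cD : #|D| = (#|U| - #|T|)%N.
  by rewrite -(cardsC [set h x | x : T]%SET) card_imset // addKn.
rewrite -cD -(@card_pffun_on _ _ y (mem D) predT).
rewrite -cardX.
pose Phi (g : {ffun U -> V}) :=
  ([ffun x => g (h x)] : {ffun T -> V}, [ffun u => if u \in D then g u else y]).
have Phi_inj : injective Phi.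
  move=> f g [/ffunP fgh /ffunP fgD]; apply/ffunP => u.
  have := fgD u; rewrite !ffunE; case: ifPn => // + _.
  by rewrite !inE negbK => /imsetP[x _ ->]; have := fgh x; rewrite !ffunE.
rewrite -(card_imset _ Phi_inj); apply: subset_leq_card.
apply/fintype.subsetP => _ /imsetP[g gA ->]; rewrite !inE /= in gA *.
rewrite gA /=; apply/pffun_onP; split=> [|v //].
by apply/supportP => u uD; rewrite ffunE (negbTE uD).
Qed.

(** Adjacency is irreflexive, so the condition for x = y always holds, and f may
    identify nonadjacent vertices. *)
Definition ind_maps (F G : lgraph) : {set {ffun vertex F -> vertex G}} :=
  [set f : {ffun vertex F -> vertex G} |
    [forall x, forall y, adj (f x) (f y) == adj x y]]%SET.

Lemma ind_mapsP (F G : lgraph) (f : {ffun vertex F -> vertex G}) :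
  reflect (forall x y, adj (f x) (f y) = adj x y) (f \in ind_maps F G).
Proof.
rewrite inE; apply: (iffP forallP) => [fP x y|fP x].
  by have /forallP/(_ y)/eqP := fP x.
by apply/forallP => y; rewrite fP.
Qed.

(** By Ramsey, each of the n ^ N maps from N points to the n vertices of G
    restricts along some injection of r.+1 points to a map counted on the right.
    There are at most N ^ r.+1 injections, and each of the counted maps extends
    in n ^ (N - r.+1) ways; the common factor n ^ (N - r.+1) cancels. *)
Lemma homogeneous_supersaturation (r : nat) (G : lgraph)
    (N := (2 ^ (r.+1 + r.+1))%N) :
  (lorder G ^ r.+1 <= N ^ r.+1 *
     (#|ind_maps (lcomplete r.+1) G| + #|ind_maps (ledgeless r.+1) G|))%N.
Proof.
set K := ind_maps _ G; set E := ind_maps _ G; set n := lorder G.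
have rN : (r.+1 <= N)%N.
  by apply: ltnW; apply: leq_trans (ltn_expl _ _) (leq_pexp2l _ (leq_addr _ _)).
have cV : #|vertex G| = n by rewrite card_ord.
pose P (h : {ffun 'I_r.+1 -> 'I_N}) :=
  [set g : {ffun 'I_N -> vertex G} | [ffun x => g (h x)] \in K :|: E]%SET.
have cov : forall g : {ffun 'I_N -> vertex G},
    exists2 h : {ffun 'I_r.+1 -> 'I_N}, injectiveb h & g \in P h.
  (* Adding the Boolean b exchanges adjacency and nonadjacency, so that both
     cases of Ramsey's theorem are relations of this form. *)
  move=> g; have esym (b : bool) : symmetric (fun x y => b (+) adj (g x) (g y)).
    by move=> x y; rewrite adj_sym.
  have fine (h : 'I_r.+1 -> 'I_N) : injective h ->
      [ffun x => g (h x)] \in K :|: E ->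
      exists2 h : {ffun 'I_r.+1 -> 'I_N}, injectiveb h & g \in P h.
    move=> hi hg; exists [ffun i => h i].
      by apply/injectiveP => i j; rewrite !ffunE => /hi.
    rewrite inE.
    suff -> : [ffun x => g ([ffun i => h i] x)] = [ffun x => g (h x)] by [].
    by apply/ffunP => i; rewrite !ffunE.
  have [|[s [us ss _ ps]]|[s [us ss _ ps]]] :=
    @ramsey_pairwise 'I_N (fun x y => adj (g x) (g y)) r.+1 r.+1 finset.setT.
  - by rewrite cardsT card_ord.
  - have [h hi hP] := pairwise_sym_enum (esym false) us ss ps.
    apply: (fine h hi); rewrite finset.in_setU; apply/orP; left.
    apply: (introT (@ind_mapsP (lcomplete r.+1) G _)) => x y.
    rewrite !ffunE /= /adj /= !ffunE; have [->|/hP //] := eqVneq x y.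
    exact: adj_irr.
  - have [h hi hP] := pairwise_sym_enum (esym true) us ss ps.
    apply: (fine h hi); rewrite finset.in_setU; apply/orP; right.
    apply: (introT (@ind_mapsP (ledgeless r.+1) G _)) => x y.
    rewrite !ffunE /= /adj /= !ffunE; have [->|/hP/negbTE //] := eqVneq x y.
    exact: adj_irr.
have : (n ^ N <= \sum_(h : {ffun 'I_r.+1 -> 'I_N} | injectiveb h) #|P h|)%N.
  have -> : (n ^ N)%N = #|[set: {ffun 'I_N -> vertex G}]%SET|.
    by rewrite cardsT card_ffun cV card_ord.
  apply: (@leq_trans
    #|(\bigcup_(h : {ffun 'I_r.+1 -> 'I_N} | injectiveb h) P h)%SET|).
    apply: subset_leq_card; apply/fintype.subsetP => g _.
    by have [h hi gh] := cov g; apply/finset.bigcupP; exists h.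
  elim/big_rec2: _ => [|h m A _ le]; first by rewrite cards0.
  by rewrite cardsU (leq_trans (leq_subr _ _)) // leq_add2l.
have bound (h : {ffun 'I_r.+1 -> 'I_N}) :
    injectiveb h -> (#|P h| <= (#|K| + #|E|) * n ^ (N - r.+1))%N.
  move=> /injectiveP hi; have := card_precomp_le (ord0 : vertex G) (K :|: E) hi.
  rewrite cV !card_ord => /leq_trans; apply; rewrite leq_mul2r.
  by rewrite cardsU leq_subr orbT.
move=> /leq_trans/(_ (leq_sum _ bound)).
rewrite sum_nat_const -(subnK rN) expnD subnK //.
have cH : (#|[pred h : {ffun 'I_r.+1 -> 'I_N} | injectiveb h]| <= N ^ r.+1)%N.
  by apply: leq_trans (max_card _) _; rewrite card_ffun !card_ord.
rewrite mulnA [X in (X <= _)%N]mulnC leq_pmul2r ?expn_gt0 //.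
by move=> /leq_trans; apply; rewrite leq_mul2r cH orbT.
Qed.

(** * Inclusion-exclusion over nonadjacent pairs *)

Lemma add_edge n (g : sgraph n) (i j : 'I_n) : i != j ->
  exists g' : sgraph n, forall x y,
    sg_adj g' x y = [|| sg_adj g x y, (x == i) && (y == j) | (x == j) && (y == i)].
Proof.
case: g => e es ij; have /andP[/forallP sym /forallP irr] := es.
pose e' := [ffun x => [ffun y =>
  [|| e x y, (x == i) && (y == j) | (x == j) && (y == i)]]].
have e's : simple e'.
  apply/andP; split; apply/forallP => x.
    apply/forallP => y; rewrite !ffunE (eqP (forallP (sym x) y)).
    by rewrite [(y == i) && _]andbC [(y == j) && _]andbC [X in _ == _ || X]orbC.
  rewrite !ffunE (negbTE (irr x)) /=.
  by apply/negP => /orP[] /andP[/eqP-> /eqP /eqP]; [|rewrite eq_sym]; apply/negP.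
by exists (SGraph e's) => x y; rewrite /= !ffunE.
Qed.

(** Interpolates between homomorphisms (S empty) and [ind_maps] (S the list of
    all nonadjacent pairs of g). *)
Definition avoiding_homs n (g : sgraph n.+1) (S : seq ('I_n.+1 * 'I_n.+1))
    (G : lgraph) : {set {ffun 'I_n.+1 -> vertex G}} :=
  [set f : {ffun 'I_n.+1 -> vertex G} |
    @is_hom (existT (fun n => sgraph n.+1) n g) G f &&
    all (fun p => ~~ adj (f p.1) (f p.2)) S]%SET.

(** One step of inclusion-exclusion: the homomorphisms that make the pair
    (i, j) adjacent are those of the graph with the edge added. *)
Lemma card_avoiding_homs_cons n (g g' : sgraph n.+1) i j S (G : lgraph) :
  (forall x y, sg_adj g' x y =
    [|| sg_adj g x y, (x == i) && (y == j) | (x == j) && (y == i)]) ->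
  (#|avoiding_homs g' S G| + #|avoiding_homs g ((i, j) :: S) G| =
   #|avoiding_homs g S G|)%N.
Proof.
move=> g'E.
rewrite -(cardsID [set f : {ffun 'I_n.+1 -> vertex G} | adj (f i) (f j)]%SET
           (avoiding_homs g S G)).
congr (_ + _)%N; apply: eq_card => f; rewrite !inE /=; last first.
  by rewrite andbCA.
rewrite andbAC; congr (_ && _); apply/idP/andP => [/forallP hf|[/forallP hf hij]].
  split; last by have /forallP/(_ j) := hf i; rewrite {1}/adj /= g'E !eqxx orbT.
  apply/forallP => x; apply/forallP => y; apply/implyP; rewrite {1}/adj /= => xy.
  by have /forallP/(_ y) := hf x; rewrite {1}/adj /= g'E xy.
apply/forallP => x; apply/forallP => y; apply/implyP; rewrite {1}/adj /= g'E.
case/or3P => [xy|/andP[/eqP-> /eqP->] //|/andP[/eqP-> /eqP->]].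
  by have /forallP/(_ y)/implyP := hf x; apply.
by rewrite adj_sym.
Qed.

Lemma ind_maps_avoiding n (g : sgraph n.+1) (G : lgraph) :
  ind_maps (existT (fun n => sgraph n.+1) n g) G =
  avoiding_homs g [seq p <- enum predT | ~~ sg_adj g p.1 p.2] G.
Proof.
apply/setP => f; rewrite !inE; apply/forallP/andP => [hf|[/forallP hf /allP na] x].
  have {}hf x y := eqP (forallP (hf x) y); split.
    by apply/forallP => x; apply/forallP => y; rewrite hf implybb.
  by apply/allP => p; rewrite mem_filter hf => /andP[].
apply/forallP => y; apply/eqP; apply/idP/idP => [|xy].
  by apply: contraLR => xy; apply: (na (x, y)); rewrite mem_filter xy mem_enum.
by have /forallP/(_ y)/implyP := hf x; apply.
Qed.

(** * Convergence of graphs to a graph limit *)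

Section Limits.
Variable R : realType.
Implicit Types (Gam : ambient R) (F : lgraph).

(** The filter along which [extend] takes limits. *)
Definition graphs_near Gam : set_system ugraph :=
  filter_from (nbhs Gam) (fun B => embed R @^-1` B).

Lemma graphs_near_filter Gam : Filter (graphs_near Gam).
Proof.
apply: filter_from_filter; first by exists setT; apply: filterT.
by move=> A B nA nB; exists (A `&` B); first exact: filterI.
Qed.

Lemma graphs_near_proper Gam : Ubar Gam -> ProperFilter (graphs_near Gam).
Proof.
move=> clG; apply: filter_from_proper; first exact: graphs_near_filter.
by move=> B /clG[_ [[G _ <-] BG]]; exists G.
Qed.
#[local] Existing Instance graphs_near_filter.

Lemma hom_density_cvg Gam (F : ugraph) :
  hom_density R F G @[G --> graphs_near Gam] --> Gam.1 F.
Proof.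
have evF : {for Gam, continuous (fun x : ambient R => x.1 F)}.
  apply: (@continuous_comp _ _ _ fst (fun f : {ptws ugraph -> R} => f F)).
    exact: cvg_fst.
  exact: (@proj_continuous _ (fun _ : ugraph => R : topologicalType) F).
by move=> A /evF nA; exists ((fun x : ambient R => x.1 F) @^-1` A).
Qed.

Lemma gorderV_cvg Gam :
  (gorder G)%:R^-1 @[G --> graphs_near Gam] --> Gam.2.
Proof.
have ev2 : {for Gam, continuous (fun x : ambient R => x.2)} by exact: cvg_snd.
by move=> A /ev2 nA; exists ((fun x : ambient R => x.2) @^-1` A).
Qed.

Lemma ambient_hausdorff : hausdorff_space (ambient R).
Proof.
move=> [p1 p2] [q1 q2] pq; congr (_, _).
  apply: (@hausdorff_product _ (fun=> R : topologicalType)).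
    by move=> _; apply: Rhausdorff.
  move=> A B nA nB.
  have [||[x1 x2] []] := pq (fst @^-1` A) (fst @^-1` B).
  - exact: (cvg_fst nA).
  - exact: (cvg_fst nB).
  - by exists x1.
apply: Rhausdorff => A B nA nB.
have [||[x1 x2] []] := pq (snd @^-1` A) (snd @^-1` B).
- exact: (cvg_snd nA).
- exact: (cvg_snd nB).
- by exists x2.
Qed.

Lemma finite_gorder_le (m : nat) : finite_set [set G | (gorder G <= m)%N].
Proof.
pose D := \bigcup_(n in `I_m)
  [set (\pi_ugraph (existT (fun n => sgraph n.+1) n g))%qT |
     g in [set: sgraph n.+1]].
apply: (@sub_finite_set _ _ D).
  move=> G /= Gm; rewrite -[G]reprK; rewrite /gorder in Gm.
  by case: (repr G) Gm => n g /= Gm; exists n => //; exists g.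
apply: bigcup_finite; first exact: finite_II.
by move=> n _; apply: finite_image; apply: finite_finset.
Qed.

(** If Gam.2 > 0, the graphs near Gam have bounded order, so there are finitely
    many of them; their image is a finite, hence closed, subset of the Hausdorff
    ambient space, so Gam would lie in it. *)
Lemma limit_order0 Gam : Uhat Gam -> Gam.2 = 0.
Proof.
move=> [Gbar Gnot]; have PF := graphs_near_proper Gbar.
have [_ /andP[G0 _]] := Ubar_unit_cube Gbar.
apply/eqP; rewrite -[_ == _]negbK; apply/negP => Gn0.
have {G0 Gn0} G0 : 0 < Gam.2 by rewrite lt_def Gn0.
have [m mG] : exists m, \forall G \near graphs_near Gam, (gorder G <= m)%N.
  exists (Num.truncn (Gam.2 / 2)^-1).
  have h : Gam.2 / 2 < Gam.2 by lra.
  near=> G.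
  have nG : Gam.2 / 2 <= (gorder G)%:R^-1.
    by near: G; apply: cvgr_ge h; apply: gorderV_cvg.
  rewrite truncn_ge_nat.
    rewrite -[leLHS]invrK lef_pV2 //; rewrite posrE ?invr_gt0 ?ltr0n //. lra.
  by rewrite invr_ge0; lra.
have clF : closed (embed R @` [set G | (gorder G <= m)%N]).
  apply: (iffLR accessible_finite_set_closed).
    exact/hausdorff_accessible/ambient_hausdorff.
  exact/finite_image/finite_gorder_le.
have : nbhs Gam (~` (embed R @` [set G | (gorder G <= m)%N])).
  apply: open_nbhs_nbhs; split; first exact: closed_openC.
  by move=> [G _ GG]; apply: Gnot; exists G.
move=> nG; have : graphs_near Gam [set G | ~ (gorder G <= m)%N].
  exists (~` (embed R @` [set G | (gorder G <= m)%N])) => // G /= nGm Gm.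
  by apply: nGm; exists G.
move=> /(filterI mG)/filter_ex[G []] /=; by [].
Unshelve. all: by end_near.
Qed.

(** * Convergence of the induced densities *)

Definition avoid_density n (g : sgraph n.+1) S (G : ugraph) : R :=
  #|avoiding_homs g S (repr G)|%:R / #|{ffun 'I_n.+1 -> vertex (repr G)}|%:R.

(** Induction on S, for all graphs g at once since the step adds an edge to g;
    for S empty this is the convergence of a homomorphism density. *)
Lemma avoid_density_cvg Gam n (g : sgraph n.+1) S :
  cvg (avoid_density g S G @[G --> graphs_near Gam]).
Proof.
elim: S g => [|[i j] S IHS] g.
  apply/cvg_ex; exists (Gam.1 (\pi_ugraph (existT (fun n => sgraph n.+1) n g))%qT).
  apply: cvg_trans (hom_density_cvg (F := _)); apply: near_eq_cvg; near=> G.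
  rewrite -[G in LHS]reprK hom_density_pi /lhom_density /avoid_density.
  by congr (_%:R / _); apply: eq_card => f; rewrite !inE andbT.
(* The pair (i, i) is always avoided, as no vertex is adjacent to itself. *)
have [<-{j}|ij] := eqVneq i j.
  suff -> : avoid_density g ((i, i) :: S) = avoid_density g S by apply: IHS.
  apply/funext => G; congr (_%:R / _); apply: eq_card => f.
  by rewrite !inE /= adj_irr.
have [g' g'E] := add_edge g ij.
have -> : avoid_density g ((i, j) :: S) =
          (fun G => avoid_density g S G - avoid_density g' S G).
  apply/funext => G; rewrite /avoid_density -(card_avoiding_homs_cons S _ g'E).
  by rewrite natrD mulrDl addrAC subrr add0r.
apply: is_cvgB; exact: IHS.
Unshelve. all: by end_near.
Qed.

Definition ind_map_density F (G : ugraph) : R :=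
  #|ind_maps F (repr G)|%:R / #|{ffun vertex F -> vertex (repr G)}|%:R.

Lemma ind_map_density_cvg Gam F :
  cvg (ind_map_density F G @[G --> graphs_near Gam]).
Proof.
case: F => n g; rewrite (_ : ind_map_density _ =
  avoid_density g [seq p <- enum predT | ~~ sg_adj g p.1 p.2]).
  exact: avoid_density_cvg.
by apply/funext => G; rewrite /ind_map_density ind_maps_avoiding.
Qed.
Arguments ind_map_density_cvg : clear implicits.

(** The product is the probability q that a random map is injective. If t is the
    induced density and c the other one, then the injective maps contribute t q
    to c and the rest at most 1 - q, so t q <= c <= t q + (1 - q) with
    0 <= t <= 1. *)
Lemma ind_density_close F (G : ugraph) : (lorder F <= gorder G)%N ->
  `|ind_map_density F G - ind_density R (\pi_ugraph F)%qT G| <=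
  1 - \prod_(i < lorder F) (1 - i%:R * (gorder G)%:R^-1).
Proof.
move=> FG; rewrite -[G in ind_density _ _ G]reprK ind_density_pi /lind_density.
rewrite -/(gorder G) FG /ind_map_density; set H := repr G.
set n := gorder G in FG *; set k := lorder F in FG *.
set J := [set f : {ffun vertex F -> vertex H} | injectiveb f]%SET.
set I := [set f : {ffun vertex F -> vertex H} | is_ind f]%SET.
set C := ind_maps F H; set A := #|{ffun _ -> _}|.
have n0 : (0 < n)%N by [].
have cJ : #|J| = (n ^_ k)%N by rewrite /J card_inj_ffuns !card_ord.
have cA : A = (n ^ k)%N by rewrite /A card_ffun !card_ord.
have I0 : (0 < #|J|)%N by rewrite cJ ffact_gt0.
have IE : I = C :&: J by apply/setP => f; rewrite !inE /is_ind andbC.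
have CJ : (#|C| <= #|I| + (A - #|J|))%N.
  have -> : (A - #|J|)%N = #|~: J|.
    by rewrite /A -(cardsC J) addKn.
  rewrite -(cardsID J C) -IE leq_add2l; apply: subset_leq_card.
  by apply/fintype.subsetP => f; rewrite !inE => /andP[].
have IC : (#|I| <= #|C|)%N by rewrite IE subset_leq_card // subsetIl.
have IJ : (#|I| <= #|J|)%N by rewrite IE subset_leq_card // subsetIr.
have JA : (#|J| <= A)%N by apply: max_card.
have -> : \prod_(i < k) (1 - i%:R * n%:R^-1) = #|J|%:R / A%:R :> R.
  rewrite cJ cA ffact_prod natr_prod natrX -[k in _ ^+ k]card_ord -prodr_const.
  rewrite -prodf_div; apply: eq_bigr => i _.
  rewrite natrB; first by rewrite mulrBl divff ?pnatr_eq0 -?lt0n.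
  exact: leq_trans (ltnW (ltn_ord i)) FG.
have A0 : (0 < A)%N by exact: leq_trans JA.
set q : R := #|J|%:R / A%:R; set t : R := _ / #|J|%:R; set c : R := _ / A%:R.
have t01 : 0 <= t <= 1.
  by rewrite divr_ge0 ?ler0n //= ler_pdivrMr ?ltr0n // mul1r ler_nat.
have q1 : q <= 1 by rewrite ler_pdivrMr ?ltr0n // mul1r ler_nat.
have tq : t * q = #|I|%:R / A%:R by rewrite mulrA divfK // pnatr_eq0 -lt0n.
have tqc : t * q <= c by rewrite tq ler_pM2r ?ler_nat // invr_gt0 ltr0n.
have ctq : c <= t * q + (1 - q).
  rewrite tq -[X in _ + (X - _)](divff (x := A%:R)) ?pnatr_eq0 -?lt0n //.
  rewrite -mulrBl -mulrDl ler_pM2r ?invr_gt0 ?ltr0n //.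
  by rewrite -natrB // -natrD ler_nat.
by rewrite ler_norml; nra.
Qed.

(** The expression is a polynomial in the inverse of the order, which tends to
    Gam.2, and this polynomial vanishes at 0. *)
Lemma falling_ratio_cvg Gam k : Gam.2 = 0 ->
  1 - \prod_(i < k) (1 - i%:R * (gorder G)%:R^-1) @[G --> graphs_near Gam] -->
  (0 : R).
Proof.
move=> Gam0; pose p : {poly R} := 1 - \prod_(i < k) (1 - i%:R *: 'X).
have pE x : p.[x] = 1 - \prod_(i < k) (1 - i%:R * x).
  rewrite !hornerE horner_prod; congr (_ - _).
  by apply: eq_bigr => i _; rewrite !hornerE.
have <- : p.[Gam.2] = 0.
  by rewrite Gam0 pE big1 ?subrr // => i _; rewrite mulr0 subr0.
under eq_fun do rewrite -pE.
apply: (@cvg_comp _ _ _ (fun G => (gorder G)%:R^-1) (fun x => p.[x])).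
  exact: gorderV_cvg.
exact: continuous_horner.
Qed.

(** The induced density is 0 by convention on graphs with fewer vertices than F,
    but only finitely many graphs are that small and they are away from Gam. *)
Lemma ind_density_extE Gam F : Uhat Gam ->
  ind_density_ext (\pi_ugraph F)%qT Gam =
  lim (ind_map_density F G @[G --> graphs_near Gam]).
Proof.
move=> GU; have Gam0 := limit_order0 GU.
have PF := graphs_near_proper GU.1.
apply: cvg_lim; first exact: Rhausdorff.
apply: cvg_sub0 (ind_map_density_cvg Gam F).
apply/norm_cvg0P.
apply: (squeeze_cvgr _ (@cvg_cst _ _ _ _ _) (falling_ratio_cvg (lorder F) Gam0)).
have VF : (0 : R) < (lorder F)%:R^-1 by rewrite invr_gt0 ltr0n.
near=> G; rewrite normr_ge0 /= distrC ind_density_close //.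
rewrite -(ler_nat R) -lef_pV2 ?posrE ?ltr0n //.
near: G; apply: cvgr_le VF; rewrite -Gam0; exact: gorderV_cvg.
Unshelve. all: by end_near.
Qed.

Lemma homogeneous_density_ge r (G : ugraph) :
  ((2 ^ (r.+1 + r.+1)) ^ r.+1)%:R^-1 <=
  ind_map_density (lcomplete r.+1) G + ind_map_density (ledgeless r.+1) G.
Proof.
have := homogeneous_supersaturation r (repr G).
rewrite /ind_map_density !card_ffun !card_ord -mulrDl.
rewrite ler_pdivlMr ?ltr0n ?expn_gt0 // mulrC ler_pdivrMr ?ltr0n ?expn_gt0 //.
by rewrite -natrD -natrM ler_nat mulnC.
Qed.

End Limits.
Arguments ind_map_density_cvg {R} Gam F.

(** * No graph limit is free of both cliques and independent sets *)

Theorem theorem9p1 (R : realType) (r : nat) (hr : (1 <= r)%N) :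
  [set Gam : ambient R | Uhat Gam
     /\ ind_density_ext (complete_graph r) Gam = 0
     /\ ind_density_ext (edgeless_graph r) Gam = 0] = set0.
Proof.
case: r hr => // r _; rewrite -subset0 => Gam [GU []].
have PF := graphs_near_proper GU.1.
rewrite /complete_graph /edgeless_graph !ind_density_extE // => K0 E0.
have : ((2 ^ (r.+1 + r.+1)) ^ r.+1)%:R^-1 <= (0 : R).
  rewrite -[leRHS]addr0 -{1}K0 -E0 -limD; [|exact: ind_map_density_cvg..].
  apply: limr_ge; first by apply: is_cvgD; exact: ind_map_density_cvg.
  by apply: nearW => G; exact: homogeneous_density_ge.
by rewrite invr_le0 lern0 -leqn0 leqNgt !expn_gt0.
Qed.
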